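(* Let $p\in\mathbb{R}$, let $r>1$ and $s$ satisfy $\frac{1}{r}+\frac{1}{s}=1$, and let $A,B\in \mathbb{B}(\mathscr{H})$, where in the case $p<1$ it is assumed that $|A|$ and $|B|$ are invertible. Then the following conditions are mutually equivalent: (1) $(r-1)(A-B)|A|^{p-1}=B(|A|^{p-1}-|B|^{p-1})$; (2) $(s-1)B(|A|^{p-1}-|B|^{p-1})=(A-B)|A|^{p-1}$; (3) $r(A-B)|A|^{p-1}+sB(|B|^{p-1}-|A|^{p-1})=0$; (4) $A|A|^{p-1}-B|B|^{p-1}=sB(|A|^{p-1}-|B|^{p-1})$.
   Context: $\mathscr{H}$ is a Hilbert space and $\mathbb{B}(\mathscr{H})$ is the algebra of bounded linear operators on $\mathscr{H}$. For $C\in\mathbb{B}(\mathscr{H})$, $|C|=(C^*C)^{1/2}$; real powers of positive operators are taken via functional calculus. *)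

(* Defs.v *)
From HB Require Import structures.
From mathcomp Require Export all_boot all_order all_algebra.
From mathcomp Require Export boolp classical_sets functions.
From mathcomp Require Export reals topology normedtype exp.
From mathcomp Require Export complex.

Set Implicit Arguments.
Unset Strict Implicit.
Unset Printing Implicit Defensive.

Import Order.TTheory GRing.Theory Num.Theory.
Import numFieldNormedType.Exports.

Local Open Scope classical_set_scope.
Local Open Scope ring_scope.
Local Open Scope complex_scope.

(* Complex Hilbert spaces; the inner product is linear in its first argument
   and conjugate-linear in the second. *)
HB.mixin Record CompleteNormedModule_isHilbert (R : realType) H
    of CompleteNormedModule R[i] H := {
  inner : {dot H for @Num.conj R[i]};
  inner_norm : forall x : H, `|x| ^+ 2 = inner x x
}.

#[short(type="hilbertType")]
HB.structure Definition Hilbert (R : realType) :=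
  {H of CompleteNormedModule_isHilbert R H & CompleteNormedModule R[i] H}.

Section BoundedOperators.
Context {R : realType} (H : hilbertType R).
Implicit Types f g : H -> H.

Definition bounded_linear f : Prop :=
  linear f /\ exists M : R, forall x, `|f x| <= M%:C * `|x|.

Definition bounded_linear_pred : {pred (H -> H)} :=
  fun f => `[< bounded_linear f >].

Lemma bounded_linear_submod : submod_closed bounded_linear_pred.
Proof.
split=> [|a f g /asboolP[lf [M fM]] /asboolP[lg [N gN]]]; apply/asboolP; split.
- by move=> a x y /=; rewrite scaler0 addr0.
- by exists 0 => x /=; rewrite normr0 mul0r.
- move=> b x y; rewrite /= !fctE lf lg !scalerDr !scalerA mulrC -!addrA.
  by congr (_ + _); rewrite addrCA.
- exists (Normc.normc a * M + N) => x; rewrite fctE.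
  rewrite (le_trans (ler_normD _ _))// !rmorphD/= mulrDl lerD//.
  rewrite normrZ rmorphM/= -mulrA.
  by apply: ler_wpM2l => //; exact: fM.
Qed.

HB.instance Definition _ := GRing.isSubmodClosed.Build R[i] (H -> H)
  bounded_linear_pred bounded_linear_submod.

Record bop := Bop { bop_fun :> H -> H; _ : bop_fun \in bounded_linear_pred }.

HB.instance Definition _ := [isSub for bop_fun].
HB.instance Definition _ := [Choice of bop by <:].
HB.instance Definition _ := [SubChoice_isSubLmodule of bop by <:].

Lemma bopP (T : bop) : bounded_linear T.
Proof. by case: T => f /= /asboolP. Qed.

Lemma bopD (S T : bop) x : (S + T) x = S x + T x.
Proof. by []. Qed.

Lemma bopZ (a : R[i]) (T : bop) x : (a *: T) x = a *: T x.
Proof. by []. Qed.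

Lemma bop1_subproof : (idfun : H -> H) \in bounded_linear_pred.
Proof. by apply/asboolP; split=> //; exists 1 => x; rewrite mul1r. Qed.

Lemma bopM_subproof (S T : bop) : S \o T \in bounded_linear_pred.
Proof.
have [lS [M SM]] := bopP S; have [lT [N TN]] := bopP T.
apply/asboolP; split=> [a x y|]; first by rewrite /= lT lS.
exists (`|M| * N) => x /=.
apply: (le_trans (SM _)); apply: (@le_trans _ _ (`|M|%:C * `|T x|)).
  by apply: ler_wpM2r => //; rewrite lecR ler_norm.
rewrite rmorphM/= -mulrA; apply: ler_wpM2l => //.
by rewrite lecR.
Qed.

End BoundedOperators.
Arguments bop {R} H.

Section Algebra.
Context {R : realType} {H : hilbertType R}.
Implicit Types S T : bop H.

Definition bop1 : bop H := Bop (bop1_subproof H).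
Definition bopM S T : bop H := Bop (bopM_subproof S T).

Lemma bop_eqP S T : (forall x, S x = T x) -> S = T.
Proof. by move=> ST; apply/val_inj/funext. Qed.

Fact bopMA : associative bopM. Proof. by move=> ? ? ?; exact: bop_eqP. Qed.
Fact bop1M : left_id bop1 bopM. Proof. by move=> ?; exact: bop_eqP. Qed.
Fact bopM1 : right_id bop1 bopM. Proof. by move=> ?; exact: bop_eqP. Qed.
Fact bopMDl : left_distributive bopM +%R.
Proof. by move=> ? ? ?; exact: bop_eqP. Qed.
Fact bopMDr : right_distributive bopM +%R.
Proof.
move=> S T U; apply: bop_eqP => x; have [lS _] := bopP S.
rewrite -[LHS]/(S (T x + U x)) -[RHS]/(S (T x) + S (U x)).
by rewrite -[T x in LHS]scale1r lS scale1r.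
Qed.

(* Only a possibly trivial ring: bop H = 0 when H = 0. *)
HB.instance Definition _ := GRing.Zmodule_isPzRing.Build (bop H)
  bopMA bop1M bopM1 bopMDl bopMDr.

Definition bop_invertible T := exists S, S * T = 1 /\ T * S = 1.

Definition opnorm T : R :=
  inf [set M : R | 0 <= M /\ forall x, `|T x| <= M%:C * `|x|].

Definition is_adjoint T S := forall x y, inner (T x) y = inner x (S y).

Definition adjoint T : bop H := xget 0 (is_adjoint T).

Definition spectrum T : set R[i] := [set z | ~ bop_invertible (T - z *: (1 : bop H))].

Definition bop_horner (q : {poly R}) T : bop H :=
  \sum_(i < size q) (q`_i)%:C *: (T ^+ i : bop H).

(* Continuous functional calculus of a self-adjoint T (so that the spectrum is
   real): f(T) is the norm limit of q_n(T) for polynomials q_n converging to f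
   uniformly on the spectrum of T. *)
Definition is_fcalc (f : R -> R) T S := exists q : nat -> {poly R},
  {uniform [set x : R | spectrum T x%:C],
    (fun n (x : R) => (q n).[x]) @ \oo --> f} /\
  opnorm (bop_horner (q n) T - S) @[n --> \oo] --> 0.

Definition fcalc (f : R -> R) T : bop H := xget 0 (is_fcalc f T).

(* Real power of a positive operator. Since 0 `^ 0 = 1, oppow T 0 is 1 even if
   T is not invertible. *)
Definition oppow T (a : R) : bop H := fcalc (fun x => x `^ a) T.

Definition absop T : bop H := oppow (adjoint T * T) 2^-1.

End Algebra.

(* Main.v *)
(** With X := (A - B) |A|^(p-1) and Y := B (|A|^(p-1) - |B|^(p-1)), one has
    A |A|^(p-1) - B |B|^(p-1) = X + Y, while 1/r + 1/s = 1 amounts to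
    (r - 1)(s - 1) = 1. All four conditions are then scalar multiples of
    X = (s - 1) Y. *)
Require Import Defs.
From mathcomp Require Import ring.

Set Implicit Arguments.
Unset Strict Implicit.
Unset Printing Implicit Defensive.

Import Order.TTheory GRing.Theory Num.Theory.
Local Open Scope ring_scope.
Local Open Scope complex_scope.

(** Clearing denominators, [(r - 1) * (s - 1) - 1 = r * s - r - s] is [r * s] times
    [1 - (r^-1 + s^-1)]. *)
Lemma conjugate_exponents (F : fieldType) (r s : F) :
  r != 0 -> r != 1 -> r^-1 + s^-1 = 1 -> (r - 1) * (s - 1) = 1.
Proof.
move=> r0 r1 rs; have s0 : s != 0.
  (* As [0^-1 = 0], taking [s = 0] would leave [r^-1 = 1], that is [r = 1]. *)
  apply: contra_neq r1 => s0.
  by rewrite -[r]invrK -[r^-1]addr0 -[0 in LHS]invr0 -s0 rs invr1.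
have -> : (r - 1) * (s - 1) = r * s * (1 - (r^-1 + s^-1)) + 1.
  by field; rewrite s0.
by rewrite rs subrr mulr0 add0r.
Qed.

Lemma conjugate_scaling_tfae (K : fieldType) (V : lmodType K) (r s : K)
    (x y : V) : r != 0 -> (r - 1) * (s - 1) = 1 ->
  [<-> (r - 1) *: x = y; (s - 1) *: y = x; r *: x - s *: y = 0;
       x + y = s *: y].
Proof.
(* Indeed [s = (s - 1) + 1 = (s - 1) + (r - 1) * (s - 1)]. *)
move=> r0 rs; have s_eq : s = r * (s - 1).
  by rewrite -[s in LHS](subrK 1) -[X in _ + X]rs; ring.
tfae.
- by move=> <-; rewrite scalerA mulrC rs scale1r.
- by move=> <-; rewrite scalerA -s_eq subrr.
(* Writing [s *: y] as [r *: ((s - 1) *: y)] lets [r] cancel. *)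
- move=> /eqP; rewrite subr_eq0 {1}s_eq -scalerA => /eqP/(scalerI r0) ->.
  by rewrite scalerBl scale1r subrK.
- move=> xy; have -> : x = (s - 1) *: y by rewrite scalerBl scale1r -xy addrK.
  by rewrite scalerA rs scale1r.
Qed.

Theorem proposition2p5 (R : realType) (H : hilbertType R) (p r s : R)
    (A B : bop H) (r_gt1 : 1 < r) (conj_rs : r^-1 + s^-1 = 1)
    (inv_AB : p < 1 -> bop_invertible (absop A) /\ bop_invertible (absop B)) :
  [<->
    (r - 1)%:C *: ((A - B) * oppow (absop A) (p - 1)) =
      B * (oppow (absop A) (p - 1) - oppow (absop B) (p - 1));
    (s - 1)%:C *: (B * (oppow (absop A) (p - 1) - oppow (absop B) (p - 1))) =
      (A - B) * oppow (absop A) (p - 1);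
    r%:C *: ((A - B) * oppow (absop A) (p - 1)) +
      s%:C *: (B * (oppow (absop B) (p - 1) - oppow (absop A) (p - 1))) = 0;
    A * oppow (absop A) (p - 1) - B * oppow (absop B) (p - 1) =
      s%:C *: (B * (oppow (absop A) (p - 1) - oppow (absop B) (p - 1)))].
Proof.
generalize (oppow (absop A) (p - 1)) (oppow (absop B) (p - 1)) => P Q.
have r0 : r != 0 by rewrite gt_eqF// (lt_trans ltr01).
have r1 : r != 1 by rewrite gt_eqF.
have rs := conjugate_exponents r0 r1 conj_rs.
have -> : A * P - B * Q = (A - B) * P + B * (P - Q).
  by rewrite mulrBl mulrBr addrA subrK.
(* The sign flip turns the third condition into [r X - s Y = 0]; the scalars become [r%:C - 1] and
   [s%:C - 1]. *)
rewrite -(opprB P Q) mulrN scalerN !rmorphB rmorph1.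
apply: conjugate_scaling_tfae; first by rewrite fmorph_eq0.
(* The real identity [rs] is carried into [R[i]] by the ring embedding. *)
by rewrite -[1]/(1%:C) -!rmorphB -rmorphM rs.
Qed.
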